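(* Let $f:\mathbb{N} \to \mathbb{C}$ be an additive function, let $k\in \mathbb{N}$ and $n_1,\ldots,n_k\in \mathbb{N}$. Then $$f([n_1,\ldots,n_k]) =\sum_{1\le j\le k} (-1)^{j-1} \sum_{1\le i_1< \cdots < i_j \le k} f((n_{i_1},\ldots,n_{i_j})).$$
   Context: $\mathbb{N}=\{1,2,\ldots\}$. A function $f:\mathbb{N}\to\mathbb{C}$ is additive if $f(mn)=f(m)+f(n)$ for all $m,n\in\mathbb{N}$ with $\gcd(m,n)=1$. $[n_1,\ldots,n_k]$ denotes the least common multiple and $(n_{i_1},\ldots,n_{i_j})$, as an argument of $f$, the greatest common divisor. *)

(* Defs.v *)
From mathcomp Require Import all_boot all_order all_algebra.
From mathcomp Require Import reals.
From mathcomp Require Import complex.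

Set Implicit Arguments.
Unset Strict Implicit.
Unset Printing Implicit Defensive.

Import GRing.Theory.
Local Open Scope ring_scope.

(* The field of complex numbers is [R[i]] for [R : realType].
   An arithmetic function on {1, 2, ...} is represented by a function on [nat];
   its value at 0 is a junk value, left unconstrained. *)
Definition additive_arith (R : realType) (f : nat -> R[i]) : Prop :=
  forall m n : nat, (0 < m)%N -> (0 < n)%N -> coprime m n ->
    f (m * n)%N = f m + f n.

(* The units 1 of [lcmn] and 0 of [gcdn] give the value of the empty family
   only; the lcm and gcd of a nonempty family are the usual ones. *)
Definition lcm_family (k : nat) (n : 'I_k -> nat) : nat :=
  \big[lcmn/1%N]_(i < k) n i.

Definition gcd_subfamily (k : nat) (n : 'I_k -> nat) (s : seq 'I_k) : nat :=
  \big[gcdn/0%N]_(i <- s) n i.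

(* Main.v *)
Require Import Defs.
From mathcomp Require Import all_boot all_order all_algebra.
From mathcomp Require Import reals.
From mathcomp Require Import complex.

Import GRing.Theory.
Local Open Scope ring_scope.

(** An additive function [f] satisfies [f a + f b = f (lcm a b) + f (gcd a b)]:
    splitting the primes [p] according to whether
    [v_p a <= v_p b] or not turns the gcd and the lcm into coprime products of
    the same four parts of [a] and [b] (lemma [additive_arith_modular]).  Thus
    [f] is a valuation on the lattice of positive integers under divisibility,
    and this lattice is distributive, so [f] obeys inclusion-exclusion.

    The induction for inclusion-exclusion is run on a statement relative to an
    ambient number [c]: the alternating sum of [f (gcd c (gcd_A n))] over all
    subsets [A] of [S], empty set included, is [f c - f (gcd c (lcm_S n))]
    (lemma [alternating_sum_gcd]).  Adding an index [x] to [S] then only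
    subtracts the same sum relative to [gcd c (n x)].  Taking for [c] the full
    lcm makes the right-hand side vanish, and isolating the empty set gives the
    formula, up to the correspondence between subsets of cardinality [j] and
    strictly increasing [j]-tuples of indices (lemma [big_sorted_tuple]). *)

Lemma additive_arith1 (R : realType) (f : nat -> R[i]) :
  additive_arith f -> f 1%N = 0.
Proof.
move=> hf; have := hf 1%N 1%N isT isT isT; rewrite muln1 => /eqP.
by rewrite -subr_eq subrr => /eqP <-.
Qed.

(** With [pi] the set of primes [p] such that [v_p a <= v_p b], the gcd takes its
    [pi]-part from [a] and its [pi^']-part from [b], and the lcm does the
    opposite; a [pi]-part and a [pi^']-part are always coprime. *)
Lemma additive_arith_modular (R : realType) (f : nat -> R[i]) :
  additive_arith f -> forall a b : nat, (0 < a)%N -> (0 < b)%N ->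
  f (lcmn a b) + f (gcdn a b) = f a + f b.
Proof.
move=> hf a b a0 b0.
pose pi : nat_pred := [pred p | (logn p a <= logn p b)%N].
have g0 : (0 < gcdn a b)%N by rewrite gcdn_gt0 a0.
have l0 : (0 < lcmn a b)%N by rewrite lcmn_gt0 a0.
have fE m : (0 < m)%N -> f m = f (m`_pi)%N + f (m`_pi^')%N.
  by move=> m0; rewrite -{1}(partnC pi m0) hf ?part_gt0 ?coprime_partC.
have gpi : ((gcdn a b)`_pi = a`_pi)%N.
  apply: eq_partn_from_log => // p /= pP.
  by rewrite logn_gcd //; apply/minn_idPl.
have gpi' : ((gcdn a b)`_pi^' = b`_pi^')%N.
  apply: eq_partn_from_log => // p; rewrite !inE -ltnNge => /ltnW pP /=.
  by rewrite logn_gcd //; apply/minn_idPr.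
have lpi : ((lcmn a b)`_pi = b`_pi)%N.
  apply: eq_partn_from_log => // p /= pP.
  by rewrite logn_lcm //; apply/maxn_idPr.
have lpi' : ((lcmn a b)`_pi^' = a`_pi^')%N.
  apply: eq_partn_from_log => // p; rewrite !inE -ltnNge => /ltnW pP /=.
  by rewrite logn_lcm //; apply/maxn_idPl.
rewrite (fE _ l0) (fE _ g0) (fE _ a0) (fE _ b0) gpi gpi' lpi lpi'.
by rewrite addrACA [RHS]addrACA; congr (_ + _); rewrite addrC.
Qed.

(** The subsets of [x |: S] come in two kinds, [A] and [x |: A] with
    [A \subset S], of opposite signs. *)
Lemma alternating_sum_setU1 (V : pzRingType) (I : finType) (x : I)
    (S : {set I}) (F : {set I} -> V) : x \notin S ->
  \sum_(A : {set I} | A \subset x |: S) (-1) ^+ #|A| * F A =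
  \sum_(A : {set I} | A \subset S) (-1) ^+ #|A| * F A -
  \sum_(A : {set I} | A \subset S) (-1) ^+ #|A| * F (x |: A).
Proof.
move=> xS; rewrite (bigID (fun A : {set I} => x \in A)) /= addrC; congr (_ + _).
  apply: eq_bigl => A; apply/andP/idP => [[/subsetP sA xA]|/subsetP sA].
    apply/subsetP => y yA; have := sA y yA; rewrite !inE.
    by case/predU1P => // yx; rewrite -yx yA in xA.
  split; first by apply/subsetP => y /sA yS; rewrite !inE yS orbT.
  by apply: contra xS => /sA.
rewrite (reindex_onto (fun A => x |: A) (fun A => A :\ x)) /=; last first.
  by move=> A /andP[_ xA]; rewrite setD1K.
rewrite -sumrN; apply: eq_big => [A|A /andP[/andP[sA _] /eqP eA]].
  rewrite setU11 andbT; apply/andP/idP => [[sA /eqP eA]|sA].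
    by rewrite -eA subDset.
  by rewrite setUS //= setU1K // (contra _ xS) // => /(subsetP sA).
have xA : x \notin A by rewrite -eA !inE eqxx.
by rewrite cardsU1 xA exprS mulN1r mulNr.
Qed.

(** The ambient number [c] is what makes the induction on [S] go through: the
    subsets containing a new index [x] contribute the same sum for the ambient
    number [gcdn c (n x)].  The empty set contributes [g c], because [0] is
    neutral for [gcdn]. *)
Lemma alternating_sum_gcd (V : pzRingType) (I : finType) (g : nat -> V)
    (g1 : g 1%N = 0)
    (gD : forall a b, (0 < a)%N -> (0 < b)%N ->
       g (lcmn a b) + g (gcdn a b) = g a + g b)
    (n : I -> nat) (hn : forall i, (0 < n i)%N) (S : {set I}) (c : nat) :
  (0 < c)%N ->
  \sum_(A : {set I} | A \subset S)
    (-1) ^+ #|A| * g (gcdn c (\big[gcdn/0%N]_(i in A) n i)) =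
  g c - g (gcdn c (\big[lcmn/1%N]_(i in S) n i)).
Proof.
elim: {S}_.+1 {-2}S (ltnSn #|S|) c => // m IHm S.
have [->|[x xS]] := set_0Vmem S => leSm c c0.
  rewrite (eq_bigl (pred1 set0)) => [|A]; last by rewrite /= subset0.
  by rewrite big_pred1_eq cards0 !big_set0 gcdn0 gcdn1 g1 subr0 mul1r.
rewrite -(setD1K xS); set S' := S :\ x.
have xS' : x \notin S' by rewrite !inE eqxx.
have ltS'm : (#|S'| < m)%N by move: leSm; rewrite (cardsD1 x) xS.
have L0 : (0 < \big[lcmn/1%N]_(i in S') n i)%N.
  by elim/big_ind: _ => // a b a0 b0; rewrite lcmn_gt0 a0.
have cx0 : (0 < gcdn c (n x))%N by rewrite gcdn_gt0 c0.
rewrite alternating_sum_setU1 // IHm // big_setU1 //=.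
rewrite (eq_bigr (fun A : {set I} => (-1) ^+ #|A| *
    g (gcdn (gcdn c (n x)) (\big[gcdn/0%N]_(i in A) n i)))); last first.
  move=> A sA; rewrite big_setU1 ?gcdnA //.
  by apply: contra xS' => /(subsetP sA).
rewrite IHm //; set L := (\big[lcmn/1%N]_(i in S') n i)%N in L0 *.
(* distributivity of the divisibility lattice, then modularity of [g] *)
rewrite [gcdn c (lcmn _ _)]gcdnC Order.NatDvd.meetUl ![gcdn _ c]gcdnC.
have := gD _ (gcdn c L) cx0; rewrite gcdn_gt0 c0 => /(_ isT).
rewrite gcdnACA gcdnn gcdnA => /(canRL (addrK _)) ->.
by rewrite !opprD !opprK !addrA; congr (_ + _); rewrite addrAC.
Qed.

(** A strictly increasing tuple is determined by its set of entries, and a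
    finite set of indices is enumerated in increasing order. *)
Lemma big_sorted_tuple (V : nmodType) (k j : nat) (F : {set 'I_k} -> V) :
  \sum_(t : j.-tuple 'I_k | sorted ltn (map val t)) F [set x in t] =
  \sum_(A : {set 'I_k} | #|A| == j) F A.
Proof.
pose h (t : j.-tuple 'I_k) := [set x in t].
pose P := [pred t : j.-tuple 'I_k | sorted ltn (map val t)].
have h_inj : {in P &, injective h}.
  move=> t u; rewrite !inE => st su /setP htu; apply/val_inj.
  apply: (inj_map val_inj); apply: (irr_sorted_eq ltn_trans ltnn st su).
  by apply: eq_mem_map => x; have := htu x; rewrite !inE.
rewrite -(big_imset F h_inj); apply: eq_bigl => A.
apply/imsetP/eqP => [[t tP ->]|cA].
  rewrite cardsE -[RHS](size_tuple t); apply/card_uniqP.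
  by rewrite -(map_inj_uniq val_inj); apply: sorted_uniq ltn_trans ltnn _ tP.
have szA : size (enum A) == j by rewrite -cardE cA.
exists (Tuple szA); last by apply/setP => x; rewrite !inE mem_enum.
rewrite inE /= {1}/enum_mem sorted_map.
apply: sorted_filter; first by move=> y x z; apply: ltn_trans.
by rewrite -sorted_map -enumT val_enum_ord iota_ltn_sorted.
Qed.

Theorem proposition1 (R : realType) (f : nat -> R[i]) (hf : additive_arith f)
    (k : nat) (hk : (0 < k)%N) (n : 'I_k -> nat) (hn : forall i, (0 < n i)%N) :
  f (lcm_family n) =
  \sum_(1 <= j < k.+1)
    (-1) ^+ j.-1 *
    \sum_(t : j.-tuple 'I_k | sorted ltn (map val t)) f (gcd_subfamily n t).
Proof.
set L := lcm_family n.
have L0 : (0 < L)%N.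
  by rewrite /L /lcm_family; elim/big_ind: _ => // a b a0 b0; rewrite lcmn_gt0 a0.
pose G (A : {set 'I_k}) := f (gcdn L (\big[gcdn/0%N]_(i in A) n i)).
have tupleE j : (0 < j)%N ->
  \sum_(t : j.-tuple 'I_k | sorted ltn (map val t)) f (gcd_subfamily n t) =
  \sum_(A : {set 'I_k} | #|A| == j) G A.
  move=> j0; rewrite -big_sorted_tuple; apply: eq_bigr => t st.
  have ut : uniq t.
    by rewrite -(map_inj_uniq val_inj); apply: sorted_uniq ltn_trans ltnn _ st.
  rewrite /G (eq_bigl (mem t)) => [|x]; last by rewrite inE.
  rewrite -big_uniq // -/(gcd_subfamily n t); congr f.
  (* a nonempty family has a member [n i], through which its gcd divides [L] *)
  symmetry; apply/gcdn_idPr.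
  case: t {st ut} => -[|i s] /= st; first by rewrite -(eqP st) in j0.
  rewrite /gcd_subfamily big_cons; apply: dvdn_trans (dvdn_gcdl _ _) _.
  exact: (biglcmn_sup i).
have := alternating_sum_gcd _ _ f (additive_arith1 _ _ hf)
  (additive_arith_modular _ _ hf) n hn [set: 'I_k] L L0.
have -> : \big[lcmn/1%N]_(i in [set: 'I_k]) n i = L.
  by apply: eq_bigl => i; rewrite inE.
rewrite gcdnn subrr (eq_bigl xpredT) => [|A]; last by rewrite subsetT.
rewrite (partition_big (fun A : {set 'I_k} => inord #|A| : 'I_k.+1) xpredT) //=.
have cardA (A : {set 'I_k}) : (inord #|A| : 'I_k.+1) = #|A| :> nat.
  by rewrite inordK // ltnS (leq_trans (max_card _)) ?card_ord.
rewrite (eq_bigr (fun j : 'I_k.+1 => (-1) ^+ j *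
    \sum_(A : {set 'I_k} | #|A| == j) G A)); last first.
  move=> j _; rewrite mulr_sumr; apply: eq_big => [A|A /eqP <-].
    by rewrite -val_eqE /= cardA.
  by rewrite cardA.
rewrite -(big_mkord xpredT (fun j => (-1) ^+ j *
    \sum_(A : {set 'I_k} | #|A| == j) G A)) big_nat_recl //.
rewrite (eq_bigl (pred1 set0)) => [|A]; last by rewrite /= cards_eq0.
rewrite big_pred1_eq /G big_set0 gcdn0 expr0 mul1r => /eqP.
rewrite addr_eq0 => /eqP ->.
rewrite big_add1 -sumrN; apply: eq_bigr => j _.
by rewrite tupleE // exprS mulN1r mulNr opprK.
Qed.
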